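(* Let $A\in\mathbb{C}^{m\times n}$, $W\in\mathbb{C}^{n\times m}$ with $\mathrm{ind}(WA)=k$, and let $G=A(WA)^k[(WA)^k]^{\dagger}$. Let $\mathrm{rank}(WAW)=r$ and $\mathrm{rank}(G)=s$, $s\le r$. Suppose that the QR decomposition of $G$ is of the form $$GP=QR,$$ where $P$ is an $n\times n$ permutation matrix, $Q\in\mathbb{C}^{m\times m}$, $Q^*Q=I_m$, and $R\in\mathbb{C}^{m\times n}$ is an upper trapezoidal matrix of rank $s$. Assume that $P$ is chosen so that $Q$ and $R$ can be partitioned as $$Q=\begin{bmatrix}Q_1&Q_2\end{bmatrix},\qquad R=\begin{bmatrix}R_{11}&R_{12}\\0&0\end{bmatrix}=\begin{bmatrix}R_1\\0\end{bmatrix},$$ where $Q_1$ consists of the first $s$ columns of $Q$ and $R_{11}\in\mathbb{C}^{s\times s}$ is non-singular. If $WAW$ has a $\{2\}$-inverse $(WAW)^{(2)}_{\mathcal{R}(G),\mathcal{N}(G)}=A^{\mathrm{cEP},W}$, then (1) $R_1P^*WAWQ_1$ is an invertible matrix; (2) $A^{\mathrm{cEP},W}=Q_1(R_1P^*WAWQ_1)^{-1}R_1P^*$; (3) $A^{\mathrm{cEP},W}=(WAW)^{(2)}_{\mathcal{R}(Q_1),\mathcal{N}(R_1P^* )}$; (4) $A^{\mathrm{cEP},W}=Q_1\big(Q_1^*A(WA)^k[(WA)^k]^{\dagger}WAWQ_1\big)^{-1}Q_1^*A(WA)^k[(WA)^k]^{\dagger}$.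
   Context: For a square complex matrix $B$, $\mathrm{ind}(B)$ is the smallest non-negative integer $j$ with $\mathrm{rank}(B^j)=\mathrm{rank}(B^{j+1})$ (with $B^0=I$). $B^*$, $B^{\dagger}$, $\mathcal{R}(B)$ and $\mathcal{N}(B)$ denote the conjugate transpose, Moore-Penrose inverse, range (column space) and null space of $B$. For $A\in\mathbb{C}^{m\times n}$, $W\in\mathbb{C}^{n\times m}$ and $p=\max\{\mathrm{ind}(AW),\mathrm{ind}(WA)\}$, the $W$-weighted core-EP inverse $A^{\mathrm{cEP},W}$ is the unique $Y\in\mathbb{C}^{m\times n}$ with $WAWY=(WA)^p[(WA)^p]^{\dagger}$ and $\mathcal{R}(Y)\subseteq\mathcal{R}((AW)^p)$. A $\{2\}$-inverse (outer inverse) of a matrix $M$ is a matrix $X$ with $XMX=X$. If $M$ has a $\{2\}$-inverse $X$ with $\mathcal{R}(X)=T$ and $\mathcal{N}(X)=S$, then $X$ is unique and is denoted $M^{(2)}_{T,S}$. *)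

(* Defs.v *)
From HB Require Import structures.
From mathcomp Require Import all_boot all_order all_algebra.
From mathcomp Require Import spectral complex reals.

Set Implicit Arguments.
Unset Strict Implicit.
Unset Printing Implicit Defensive.

Import Order.TTheory GRing.Theory Num.Theory.
Local Open Scope ring_scope.
Local Open Scope sesquilinear_scope.

Lemma mxrankX_leS (F : fieldType) n (B : 'M[F]_n) j :
  (\rank (B ^+ j.+1) <= \rank (B ^+ j))%N.
Proof. by rewrite exprSr mxrankM_maxl. Qed.

Lemma ind_subproof (F : fieldType) n (B : 'M[F]_n) :
  exists j, \rank (B ^+ j) == \rank (B ^+ j.+1).
Proof.
have [/existsP[j Hj] | ] :=
  boolP [exists j : 'I_n.+1, \rank (B ^+ j) == \rank (B ^+ j.+1)].
  by exists j.
rewrite negb_exists => /forallP H.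
suff Hk k : (k <= n.+1)%N -> (\rank (B ^+ k) + k <= n)%N.
  by have /(leq_trans (leq_addl _ _)) := Hk _ (leqnn _); rewrite ltnn.
elim: k => [|k IHk] hk; first by rewrite addn0 rank_leq_row.
apply: leq_trans (IHk (ltnW hk)); rewrite addnS -addSn leq_add2r.
by rewrite ltn_neqAle mxrankX_leS andbT eq_sym (H (Ordinal hk)).
Qed.

Definition ind (F : fieldType) n (B : 'M[F]_n) : nat := ex_minn (ind_subproof B).

(* Matrices act on column vectors, so the range is the column space; the row
   space order (_ <= _)%MS of mxalgebra is not the one needed here. *)
Definition mxrange (F : fieldType) m n (B : 'M[F]_(m, n)) : {vspace 'cV[F]_m} :=
  limg (linfun (mulmx B : 'cV[F]_n -> 'cV[F]_m)).

Definition mxnull (F : fieldType) m n (B : 'M[F]_(m, n)) : {vspace 'cV[F]_n} :=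
  lker (linfun (mulmx B : 'cV[F]_n -> 'cV[F]_m)).

Lemma memv_mxrangeP (F : fieldType) m n (B : 'M[F]_(m, n)) (v : 'cV[F]_m) :
  reflect (exists u, v = B *m u) (v \in mxrange B).
Proof.
by apply: (iffP memv_imgP) => [[u _ ->]|[u ->]]; exists u; rewrite ?lfunE ?memvf.
Qed.

Lemma memv_mxnull (F : fieldType) m n (B : 'M[F]_(m, n)) (v : 'cV[F]_n) :
  (v \in mxnull B) = (B *m v == 0).
Proof. by rewrite memv_ker lfunE. Qed.

Lemma mxrange_subP (F : fieldType) m n p (B : 'M[F]_(m, n)) (D : 'M[F]_(m, p)) :
  reflect (exists Z, B = D *m Z) (mxrange B <= mxrange D)%VS.
Proof.
apply: (iffP subvP) => [sBD | [Z ->] v /memv_mxrangeP[u ->]]; last first.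
  by apply/memv_mxrangeP; exists (Z *m u); rewrite mulmxA.
have H j : exists u, col j B == D *m u.
  have /sBD/memv_mxrangeP[u ->] : col j B \in mxrange B by
    apply/memv_mxrangeP; exists (delta_mx j 0); rewrite colE.
  by exists u.
exists (\matrix_(i, j) xchoose (H j) i 0); apply/matrixP => i j.
have /eqP/colP/(_ i) := xchooseP (H j).
by rewrite !mxE => ->; apply: eq_bigr => l _; rewrite !mxE.
Qed.

(* The four Penrose equations. *)
Definition is_mpinv (C : numClosedFieldType) m n
    (B : 'M[C]_(m, n)) (X : 'M[C]_(n, m)) : bool :=
  [&& B *m X *m B == B, X *m B *m X == X,
      (B *m X)^t* == B *m X & (X *m B)^t* == X *m B].

Lemma trmxC_mul (C : numClosedFieldType) m n p
  (A : 'M[C]_(m, n)) (B : 'M[C]_(n, p)) : (A *m B)^t* = B^t* *m A^t*.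
Proof. by rewrite trmx_mul map_mxM. Qed.

Lemma trmxC_inv (C : numClosedFieldType) n (A : 'M[C]_n) :
  (invmx A)^t* = invmx (A^t*).
Proof. by rewrite trmx_inv map_invmx. Qed.

Lemma mulmxtC_eq0 (C : numClosedFieldType) m n (A : 'M[C]_(m, n)) :
  A *m A^t* = 0 -> A = 0.
Proof.
move=> A0; apply/matrixP => i j; apply/eqP; rewrite mxE.
have /matrixP/(_ i i)/eqP := A0; rewrite !mxE psumr_eq0 => [/allP/(_ j)|l _].
  by rewrite mem_index_enum !mxE mulf_eq0 conjC_eq0 orbb => /(_ isT).
by rewrite !mxE mul_conjC_ge0.
Qed.

Lemma gram_unitmx (C : numClosedFieldType) m n (A : 'M[C]_(m, n)) :
  row_free A -> A *m A^t* \in unitmx.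
Proof.
move=> fA; rewrite -row_free_unit -kermx_eq0; apply/eqP.
apply: (row_free_inj fA); rewrite mul0mx; apply: mulmxtC_eq0.
by rewrite trmxC_mul mulmxA -(mulmxA _ A) mulmx_ker mul0mx.
Qed.

Lemma mpinv_exists (C : numClosedFieldType) m n (B : 'M[C]_(m, n)) :
  exists X, is_mpinv B X.
Proof.
have [r [L [U [LU fU fL]]]] : exists r, exists L : 'M[C]_(m, r),
    exists U : 'M[C]_(r, n), [/\ L *m U = B, row_free U & row_free (L^t*)].
  exists (\rank B), (col_base B), (row_base B).
  split; [exact: mulmx_base | exact: row_base_free |].
  by rewrite /row_free mxrank_map mxrank_tr; have := col_base_full B.
have uU : U *m U^t* \in unitmx by exact: gram_unitmx.
have uL : L^t* *m L \in unitmx by rewrite -{2}[L]trmxCK; exact: gram_unitmx.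
set IU := invmx (U *m U^t*); set IL := invmx (L^t* *m L).
exists (U^t* *m IU *m IL *m L^t*).
have hBX : B *m (U^t* *m IU *m IL *m L^t*) = L *m IL *m L^t*.
  by rewrite -LU !mulmxA -(mulmxA L U) -(mulmxA L) mulmxV // mulmx1.
have hXB : (U^t* *m IU *m IL *m L^t*) *m B = U^t* *m IU *m U.
  by rewrite -LU !mulmxA -(mulmxA _ (L^t*)) -(mulmxA _ IL) mulVmx // mulmx1.
have sIU : IU^t* = IU by rewrite /IU trmxC_inv trmxC_mul trmxCK.
have sIL : IL^t* = IL by rewrite /IL trmxC_inv trmxC_mul trmxCK.
apply/and4P; split; apply/eqP; rewrite ?hBX ?hXB.
- by rewrite -{1}LU mulmxA -(mulmxA _ (L^t*)) -(mulmxA _ IL) mulVmx // mulmx1 LU.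
- by rewrite !mulmxA -(mulmxA _ U) -(mulmxA _ IU (U *m _)) mulVmx // mulmx1.
- by rewrite !trmxC_mul trmxCK sIL mulmxA.
- by rewrite !trmxC_mul trmxCK sIU mulmxA.
Qed.

Definition mpinv (C : numClosedFieldType) m n (B : 'M[C]_(m, n)) : 'M[C]_(n, m) :=
  xchoose (mpinv_exists B).

Lemma mpinvP (C : numClosedFieldType) m n (B : 'M[C]_(m, n)) :
  is_mpinv B (mpinv B).
Proof. exact: xchooseP. Qed.

Lemma mpinv_unique (C : numClosedFieldType) m n (B : 'M[C]_(m, n)) X :
  is_mpinv B X -> X = mpinv B.
Proof.
have := mpinvP B; move: (mpinv B) => Y.
case/and4P=> /eqP y1 /eqP y2 /eqP y3 /eqP y4.
case/and4P=> /eqP x1 /eqP x2 /eqP x3 /eqP x4.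
have e1 : B *m X = B *m Y.
  by rewrite -x3 -{1}y1 -[_ *m B *m X]mulmxA trmxC_mul x3 y3 mulmxA x1.
have e2 : X *m B = Y *m B.
  by rewrite -x4 -{1}y1 -(mulmxA B) mulmxA trmxC_mul x4 y4 -!mulmxA (mulmxA B X) x1.
by rewrite -x2 -mulmxA e1 mulmxA e2.
Qed.

Definition wcep_order (F : fieldType) m n (A : 'M[F]_(m, n)) (W : 'M[F]_(n, m)) :=
  maxn (ind (A *m W)) (ind (W *m A)).

(* W A W Y is the orthogonal projector onto the range of (W A)^p; together with
   the range condition this determines Y, see wcep_exists and wcep_unique. *)
Definition is_wcep (C : numClosedFieldType) m n
    (A : 'M[C]_(m, n)) (W : 'M[C]_(n, m)) (Y : 'M[C]_(m, n)) : bool :=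
  let p := wcep_order A W in
  (W *m A *m W *m Y == (W *m A) ^+ p *m mpinv ((W *m A) ^+ p))
  && (mxrange Y <= mxrange ((A *m W) ^+ p))%VS.

Lemma expmxSr (F : fieldType) n (B : 'M[F]_n) k : B ^+ k.+1 = B ^+ k *m B.
Proof. exact: exprSr. Qed.

Lemma expmxS (F : fieldType) n (B : 'M[F]_n) k : B ^+ k.+1 = B *m B ^+ k.
Proof. exact: exprS. Qed.

Lemma expmxD (F : fieldType) n (B : 'M[F]_n) j k :
  B ^+ (j + k) = B ^+ j *m B ^+ k.
Proof. exact: exprD. Qed.

Lemma rank_ind (F : fieldType) n (B : 'M[F]_n) :
  \rank (B ^+ ind B) = \rank (B ^+ (ind B).+1).
Proof. by rewrite /ind; case: ex_minnP => q /eqP. Qed.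

Lemma expmx_indr (F : fieldType) n (B : 'M[F]_n) k j :
  (ind B <= k)%N -> exists Z, B ^+ k = B ^+ (k + j) *m Z.
Proof.
have [Z1 hZ1] : exists Z1, B ^+ (ind B) = B ^+ (ind B + 1) *m Z1.
  have /submxP[D hD] : ((B ^+ (ind B))^T <= (B ^+ (ind B + 1))^T)%MS.
    have s1 : ((B ^+ (ind B + 1))^T <= (B ^+ (ind B))^T)%MS.
      by rewrite expmxD trmx_mul submxMl.
    by rewrite -(geq_leqif (mxrank_leqif_sup s1)) !mxrank_tr addn1 rank_ind.
  by exists D^T; apply: trmx_inj; rewrite trmx_mul trmxK.
have [Z hZ] : exists Z, B ^+ (ind B) = B ^+ (ind B + j) *m Z.
  elim: j => [|i [Z hZ]]; first by exists 1%:M; rewrite addn0 mulmx1.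
  exists (Z1 *m Z); have -> : (ind B + i.+1 = i + (ind B + 1))%N.
    by rewrite addn1 addnC addSnnS.
  by rewrite {1}hZ (addnC _ i) !(expmxD _ i) {1}hZ1 !mulmxA.
move=> /subnK <-; exists Z.
by rewrite -addnA !expmxD {1}hZ expmxD !mulmxA.
Qed.

Lemma expmx_indl (F : fieldType) n (B : 'M[F]_n) k j :
  (ind B <= k)%N -> exists Z, B ^+ k = Z *m B ^+ (j + k).
Proof.
have [Z1 hZ1] : exists Z1, B ^+ (ind B) = Z1 *m B ^+ (1 + ind B).
  apply/submxP.
  have s1 : (B ^+ (1 + ind B) <= B ^+ (ind B))%MS by rewrite expmxD submxMl.
  by rewrite -(geq_leqif (mxrank_leqif_sup s1)) add1n rank_ind.
have [Z hZ] : exists Z, B ^+ (ind B) = Z *m B ^+ (j + ind B).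
  elim: j => [|i [Z hZ]]; first by exists 1%:M; rewrite mul1mx.
  exists (Z *m Z1); have -> : (i.+1 + ind B = (1 + ind B) + i)%N.
    by rewrite add1n addSnnS addnC.
  by rewrite {1}hZ (addnC i) !(expmxD _ _ i) {1}hZ1 !mulmxA.
move=> /subnKC <-; exists Z.
by rewrite addnA !expmxD {1}hZ expmxD !mulmxA.
Qed.

Lemma mulmx_expC (F : fieldType) m n (A : 'M[F]_(m, n)) (W : 'M[F]_(n, m)) k :
  W *m (A *m W) ^+ k = (W *m A) ^+ k *m W.
Proof.
elim: k => [|k IHk]; first by rewrite !expr0 mulmx1 mul1mx.
by rewrite !expmxSr mulmxA IHk -!mulmxA.
Qed.

Lemma mpinv_proj (C : numClosedFieldType) m n p (B : 'M[C]_(m, n))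
    (D : 'M[C]_(m, p)) X Y : B = D *m X -> D = B *m Y ->
  D *m mpinv D = B *m mpinv B.
Proof.
move=> hB hD; have /and4P[/eqP b1 _ /eqP b3 _] := mpinvP B.
have /and4P[/eqP d1 _ /eqP d3 _] := mpinvP D.
have e1 : B *m mpinv B *m D = D by rewrite {1}hD mulmxA b1 -hD.
have e2 : D *m mpinv D *m B = B by rewrite {1}hB mulmxA d1 -hB.
rewrite -d3 -{1}e1 -[_ *m D *m _]mulmxA trmxC_mul d3 b3.
by rewrite mulmxA e2.
Qed.

Lemma wcep_exists (C : numClosedFieldType) m n
  (A : 'M[C]_(m, n)) (W : 'M[C]_(n, m)) : exists Y, is_wcep A W Y.
Proof.
set p := wcep_order A W; set D := (W *m A) ^+ p.+1 *m W.
have [Z hZ] : exists Z, (W *m A) ^+ p = (W *m A) ^+ (p + 2) *m Z.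
  by apply: expmx_indr; rewrite leq_maxr.
exists ((A *m W) ^+ p *m mpinv D); apply/andP; split; last first.
  by apply/mxrange_subP; exists (mpinv D).
have -> : W *m A *m W *m ((A *m W) ^+ p *m mpinv D) = D *m mpinv D.
  by rewrite mulmxA -(mulmxA (W *m A)) mulmx_expC mulmxA -expmxS.
apply/eqP; apply: (@mpinv_proj _ _ _ _ _ _ (A *m Z) (W *m A *m W)).
  by rewrite {1}hZ /D addn2 expmxSr !mulmxA.
by rewrite /D expmxSr -!mulmxA.
Qed.

Definition wcep (C : numClosedFieldType) m n
    (A : 'M[C]_(m, n)) (W : 'M[C]_(n, m)) : 'M[C]_(m, n) :=
  xchoose (wcep_exists A W).

Lemma wcepP (C : numClosedFieldType) m n
  (A : 'M[C]_(m, n)) (W : 'M[C]_(n, m)) : is_wcep A W (wcep A W).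
Proof. exact: xchooseP. Qed.

Lemma wcep_unique (C : numClosedFieldType) m n
    (A : 'M[C]_(m, n)) (W : 'M[C]_(n, m)) Y :
  is_wcep A W Y -> Y = wcep A W.
Proof.
have := wcepP A W; move: (wcep A W) => X.
rewrite /is_wcep; set p := wcep_order A W.
case/andP=> /eqP hX /mxrange_subP[X' eX] /andP[/eqP hY /mxrange_subP[Y' eY]].
have [Z hZ] : exists Z, (A *m W) ^+ p = Z *m (A *m W) ^+ (2 + p).
  by apply: expmx_indl; rewrite leq_maxl.
have key N N' : N = (A *m W) ^+ p *m N' -> N = Z *m A *m (W *m A *m W *m N).
  move=> ->; rewrite [LHS](congr1 (mulmx^~ N') hZ).
  by rewrite expmxD expr2 -mulmxE !mulmxA.
by rewrite (key _ _ _ eY) hY -hX -(key _ _ _ eX).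
Qed.

(* The partial notation M^(2)_{T,S} as a relation: X exists and is M^(2)_{T,S}.
   It is functional in X by is_outer_inverse_unique below. *)
Definition is_outer_inverse (F : fieldType) m n (M : 'M[F]_(m, n))
    (T : {vspace 'cV[F]_n}) (S : {vspace 'cV[F]_m}) (X : 'M[F]_(n, m)) : bool :=
  [&& X *m M *m X == X, mxrange X == T & mxnull X == S].

Lemma is_outer_inverse_unique (F : fieldType) m n (M : 'M[F]_(m, n)) T S X Y :
  is_outer_inverse M T S X -> is_outer_inverse M T S Y -> X = Y.
Proof.
case/and3P=> /eqP hX /eqP <- /eqP <- /and3P[/eqP hY /eqP rXY /eqP nXY].
have [Z hZ] : exists Z, X = Y *m Z by apply/mxrange_subP; rewrite rXY.
have XY : X = Y *m M *m X by rewrite hZ !mulmxA hY.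
suff : Y *m (1%:M - M *m X) = 0.
  by rewrite mulmxBr mulmx1 mulmxA -XY => /subr0_eq.
have X0 : X *m (1%:M - M *m X) = 0 by rewrite mulmxBr mulmx1 mulmxA hX subrr.
apply/matrixP => i j; apply/eqP.
suff /eqP/colP/(_ i) : Y *m col j (1%:M - M *m X) == 0.
  by rewrite colE mulmxA -colE !mxE => ->.
by rewrite -memv_mxnull nXY memv_mxnull colE mulmxA X0 mul0mx.
Qed.

(* Main.v *)
Require Import Defs.
From HB Require Import structures.
From mathcomp Require Import all_boot all_order all_algebra.
From mathcomp Require Import spectral complex reals.
From mathcomp Require Import perm.

(** The QR decomposition yields a full-rank factorization G = Q1 (R1 P^* ): the
columns of Q1 are orthonormal, so Q1 is left invertible with inverse Q1^*, and
R1 P^* is right invertible because R11 is non-singular and P is unitary. A left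
invertible left factor does not change the null space and a right invertible
right factor does not change the range, so R(G) = R(Q1) and
N(G) = N(R1 P^* ), which turns the hypothesis on the outer inverse
into (3) ([outer_inverse_full_rank_factors]).

The rest is a fact about any outer inverse X of M whose range is that of a left
invertible U and whose null space is that of a right invertible V: the range and
null space force X = U K V with K square, the equality of ranges makes K
invertible, and cancelling U and V in X M X = X leaves K (V M U) K = K. Thus
V M U is the inverse of K ([outer_inverse_representation]). Taking M = W A W,
U = Q1 and V = R1 P^* gives (1) and (2). Finally Q1^* G = R1 P^*, so
the matrices in (4) are those of (1) and (2). *)

Set Implicit Arguments.
Unset Strict Implicit.
Unset Printing Implicit Defensive.

Import Order.TTheory GRing.Theory Num.Theory.
Local Open Scope ring_scope.
Local Open Scope sesquilinear_scope.

Lemma mxnull_mulmx0 (F : fieldType) m n p q (V : 'M[F]_(m, n))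
    (X : 'M[F]_(p, n)) (D : 'M[F]_(n, q)) :
  (mxnull V <= mxnull X)%VS -> V *m D = 0 -> X *m D = 0.
Proof.
move=> /subvP sVX VD0; apply/matrixP => i j.
have /sVX : col j D \in mxnull V by rewrite memv_mxnull colE mulmxA VD0 mul0mx.
by rewrite memv_mxnull colE mulmxA -colE => /eqP/colP/(_ i); rewrite !mxE.
Qed.

Lemma mxrange_mulr_rinv (F : fieldType) m n s (U : 'M[F]_(m, s))
    (V : 'M[F]_(s, n)) (N : 'M[F]_(n, s)) :
  V *m N = 1%:M -> mxrange (U *m V) = mxrange U.
Proof.
move=> VN; apply/eqP; rewrite eqEsubv; apply/andP.
split; apply/mxrange_subP; first by exists V.
by exists N; rewrite -mulmxA VN mulmx1.
Qed.

Lemma mxnull_mull_linv (F : fieldType) m n s (U : 'M[F]_(m, s))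
    (V : 'M[F]_(s, n)) (L : 'M[F]_(s, m)) :
  L *m U = 1%:M -> mxnull (U *m V) = mxnull V.
Proof.
move=> LU; apply/vspaceP => v; rewrite !memv_mxnull -mulmxA.
apply/eqP/eqP => [UVv0|->]; last by rewrite mulmx0.
by rewrite -[LHS]mul1mx -LU -mulmxA UVv0 mulmx0.
Qed.

Lemma outer_inverse_full_rank_factors (F : fieldType) m n s (M : 'M[F]_(n, m))
    (U : 'M[F]_(m, s)) (V : 'M[F]_(s, n)) (L : 'M[F]_(s, m)) (N : 'M[F]_(n, s))
    (X : 'M[F]_(m, n)) :
    L *m U = 1%:M -> V *m N = 1%:M ->
  is_outer_inverse M (mxrange (U *m V)) (mxnull (U *m V)) X =
  is_outer_inverse M (mxrange U) (mxnull V) X.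
Proof. by move=> LU VN; rewrite (mxrange_mulr_rinv U VN) (mxnull_mull_linv V LU). Qed.

(** The one-sided inverses L and N recover the middle factor K = L X N of
X = U K V. It is invertible because U = X Z for some Z, hence K (V Z) = 1, and
then X M X = X says that V M U inverts it. *)
Lemma outer_inverse_representation (F : fieldType) m n s (M : 'M[F]_(n, m))
    (U : 'M[F]_(m, s)) (V : 'M[F]_(s, n)) (L : 'M[F]_(s, m)) (N : 'M[F]_(n, s))
    (X : 'M[F]_(m, n)) :
    L *m U = 1%:M -> V *m N = 1%:M ->
    is_outer_inverse M (mxrange U) (mxnull V) X ->
  V *m M *m U \in unitmx /\ X = U *m invmx (V *m M *m U) *m V.
Proof.
move=> LU VN /and3P[/eqP XMX /eqP rX /eqP nX].
have XNV : X *m N *m V = X.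
  (* The columns of 1 - N V lie in the null space of V, which is that of X. *)
  have : X *m (1%:M - N *m V) = 0.
    apply: (@mxnull_mulmx0 _ _ _ _ _ V); first by rewrite nX.
    by rewrite mulmxBr mulmx1 mulmxA VN mul1mx subrr.
  by rewrite mulmxBr mulmx1 mulmxA => /subr0_eq.
have ULX : U *m (L *m X) = X.
  have /mxrange_subP[Z ->] : (mxrange X <= mxrange U)%VS by rewrite rX.
  by rewrite (mulmxA L) LU mul1mx.
pose K := L *m X *m N.
have XE : X = U *m K *m V by rewrite /K !mulmxA -(mulmxA U) ULX XNV.
have /mxrange_subP[Z UZ] : (mxrange U <= mxrange X)%VS by rewrite rX.
have KVZ : K *m (V *m Z) = 1%:M.
  by rewrite -LU [in RHS]UZ [in RHS]XE !mulmxA LU mul1mx.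
have [uK _] := mulmx1_unit KVZ.
have KHK : K *m (V *m M *m U) *m K = K.
  have /(congr1 (fun Y => L *m Y *m N)) := XMX.
  rewrite XE !mulmxA LU !mul1mx => e.
  by rewrite -[RHS]mulmx1 -VN mulmxA -[RHS]e -!mulmxA VN mulmx1.
have HK : V *m M *m U *m K = 1%:M.
  by apply: (can_inj (mulKmx uK)); rewrite mulmxA mulmx1 KHK.
have [uH _] := mulmx1_unit HK.
by split=> //; rewrite -[invmx _]mulmx1 -HK mulKmx.
Qed.

Lemma perm_mx_trmxC (C : numClosedFieldType) n (P : 'M[C]_n) :
  is_perm_mx P -> P *m P^t* = 1%:M.
Proof.
move=> /is_perm_mxP[t ->].
by rewrite tr_perm_mx map_perm_mx -perm_mxM mulgV perm_mx1.
Qed.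

(** A QR factorization with column pivoting only sees the first s columns of Q,
because the other rows of R vanish; what remains is a full-rank factorization of
G, with an explicit right inverse of the factor R1 P^* read off from the
invertible block R11. *)
Lemma pivoted_qr_full_rank (C : numClosedFieldType) (s m2 n2 : nat)
    (G : 'M[C]_(s + m2, s + n2)) (P : 'M[C]_(s + n2))
    (Q1 : 'M[C]_(s + m2, s)) (Q2 : 'M[C]_(s + m2, m2))
    (R11 : 'M[C]_s) (R12 : 'M[C]_(s, n2)) :
    is_perm_mx P -> (row_mx Q1 Q2)^t* *m row_mx Q1 Q2 = 1%:M ->
    R11 \in unitmx ->
    G *m P = row_mx Q1 Q2 *m block_mx R11 R12 0 0 ->
  [/\ G = Q1 *m (row_mx R11 R12 *m P^t*), Q1^t* *m Q1 = 1%:M &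
     row_mx R11 R12 *m P^t* *m (P *m col_mx (invmx R11) 0) = 1%:M].
Proof.
move=> /perm_mx_trmxC PP' QQ uR GP; have P'P := mulmx1C PP'; split.
- rewrite -[G]mulmx1 -PP' mulmxA GP /block_mx mul_row_col row_mx0 mulmx0 addr0.
  by rewrite mulmxA.
- move: QQ; rewrite tr_row_mx map_col_mx mul_col_row scalar_mx_block.
  by case/eq_block_mx.
- rewrite -mulmxA (mulmxA _ P) P'P mul1mx mul_row_col mulmx0 addr0.
  exact: mulmxV.
Qed.

Theorem corollary2p9 (K : realType) (m n k r s m2 n2 : nat)
  (A : 'M[K[i]]_(m, n)) (W : 'M[K[i]]_(n, m)) (G : 'M[K[i]]_(m, n))
  (P : 'M[K[i]]_n) (Q : 'M[K[i]]_m) (R : 'M[K[i]]_(m, n))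
  (hm : (s + m2)%N = m) (hn : (s + n2)%N = n)
  (Q1 : 'M[K[i]]_(m, s)) (Q2 : 'M[K[i]]_(m, m2))
  (R11 : 'M[K[i]]_s) (R12 : 'M[K[i]]_(s, n2)) (R1 : 'M[K[i]]_(s, n))
  (hk : ind (W *m A) = k)
  (hG : G = A *m (W *m A) ^+ k *m mpinv ((W *m A) ^+ k))
  (hr : \rank (W *m A *m W) = r)
  (hs : \rank G = s)
  (hsr : (s <= r)%N)
  (hP : is_perm_mx P)
  (hQR : G *m P = Q *m R)
  (hQ : Q^t* *m Q = 1%:M)
  (hRtrap : is_trig_mx R^T)
  (hRrank : \rank R = s)
  (hQblock : Q = castmx (erefl m, hm) (row_mx Q1 Q2))
  (hRblock : R = castmx (hm, hn) (block_mx R11 R12 0 0))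
  (hR1 : R1 = castmx (erefl s, hn) (row_mx R11 R12))
  (hR11 : R11 \in unitmx)
  (hout : is_outer_inverse (W *m A *m W) (mxrange G) (mxnull G) (wcep A W)) :
  [/\ R1 *m P^t* *m (W *m A *m W) *m Q1 \in unitmx,
      wcep A W =
        Q1 *m invmx (R1 *m P^t* *m (W *m A *m W) *m Q1) *m (R1 *m P^t*),
      is_outer_inverse (W *m A *m W) (mxrange Q1) (mxnull (R1 *m P^t*))
        (wcep A W)
    & Q1^t* *m (A *m (W *m A) ^+ k *m mpinv ((W *m A) ^+ k))
        *m (W *m A *m W) *m Q1 \in unitmx
      /\ wcep A W =
        Q1 *m invmx (Q1^t* *m (A *m (W *m A) ^+ k *m mpinv ((W *m A) ^+ k))
                       *m (W *m A *m W) *m Q1)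
           *m (Q1^t* *m (A *m (W *m A) ^+ k *m mpinv ((W *m A) ^+ k)))].
Proof.
subst m n; rewrite castmx_id in hQblock; rewrite castmx_id in hRblock.
rewrite castmx_id in hR1; rewrite -hG.
rewrite hQblock in hQ; rewrite hQblock hRblock in hQR.
have [GE QQ RN] := pivoted_qr_full_rank hP hQ hR11 hQR.
rewrite -hR1 in GE RN.
have QG : Q1^t* *m G = R1 *m P^t* by rewrite GE mulmxA QQ mul1mx.
move: hout; rewrite GE (outer_inverse_full_rank_factors _ _ QQ RN) -GE => out3.
have [unit1 eq2] := outer_inverse_representation QQ RN out3.
by rewrite QG; split.
Qed.
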